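(* Let $(\mathcal V,p,e)$ be a hyperbolic system of degree $n$. Suppose the $\mathcal V$-matrices $\mathbf A=[a_1,a_2,\dots,a_n]$ and $\mathbf B=[b_1,b_2,\dots,b_n]$ are $e$-doubly stochastic. Then the linear transformation $\mathbf A\odot\mathbf B:\mathcal V\to\mathcal V$, $(\mathbf A\odot\mathbf B)(x)=\sum_{i=1}^n\langle b_i,x\rangle a_i$, is $\lambda$-doubly stochastic, that is, $\lambda\big((\mathbf A\odot\mathbf B)(x)\big)\prec\lambda(x)$ for all $x\in\mathcal V$. Consequently, when $p$ is complete, $\mathbf A\odot\mathbf B$ is an operator doubly stochastic transformation.
   Context: A hyperbolic system $(\mathcal V,p,e)$ of degree $n$ consists of a nonzero finite-dimensional real vector space $\mathcal V$, a nonzero element $e\in\mathcal V$, and a real homogeneous polynomial $p$ of degree $n$ on $\mathcal V$ such that $p(e)\neq 0$ and, for each $x\in\mathcal V$, the univariate polynomial $t\mapsto p(te-x)$ has only real zeros. For $x\in\mathcal V$, $\lambda(x)=(\lambda_1(x),\dots,\lambda_n(x))^T\in\mathbb R^n$ is the vector of these zeros (with multiplicity) in decreasing order. The hyperbolicity cone is $\Lambda_+=\{x\in\mathcal V:\lambda(x)\ge 0\}$. The trace is $\operatorname{tr}(x)=\sum_{i=1}^n\lambda_i(x)$. The polynomial $p$ is complete if $\lambda(x)=0$ implies $x=0$. $\mathcal V$ carries the semi-inner product $\langle x,y\rangle=\frac14\big[\|\lambda(x+y)\|^2-\|\lambda(x-y)\|^2\big]$ (Euclidean norm on $\mathbb R^n$),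 which is known to be bilinear and positive semidefinite, and is an inner product when $p$ is complete. A $\mathcal V$-matrix is an $n$-tuple $[a_1,\dots,a_n]$ of elements of $\mathcal V$. It is $e$-doubly stochastic if $a_i\in\Lambda_+$ and $\operatorname{tr}(a_i)=1$ for all $i$, and $a_1+\dots+a_n=e$. A linear transformation $T:\mathcal V\to\mathcal V$ is operator doubly stochastic if $T(\Lambda_+)\subseteq\Lambda_+$, $T(e)=e$, and $\operatorname{tr}(T(x))=\operatorname{tr}(x)$ for all $x\in\mathcal V$. Majorization in $\mathbb R^n$: $r\prec s$ means $\sum_{i=1}^k r_i^\downarrow\le\sum_{i=1}^k s_i^\downarrow$ for all $1\le k\le n$, with equality for $k=n$, where $r^\downarrow$ is the decreasing rearrangement of $r$. *)

(* Defs.v *)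
From HB Require Import structures.
From mathcomp Require Import all_boot all_order all_algebra.
From mathcomp Require Import zify.
From mathcomp Require Import reals complex polyrcf mpoly.

Set Implicit Arguments.
Unset Strict Implicit.
Unset Printing Implicit Defensive.

Import Order.TTheory GRing.Theory Num.Theory.
Local Open Scope ring_scope.

Section PolynomialsOnASpace.
Variables (R : realType) (V : vectType R).

(* A real polynomial on V is represented by its expression in the coordinates
   relative to the basis [vbasis {:V}] of V. Over the infinite field R this
   representation is unique, and homogeneity and degree do not depend on the
   choice of the basis. *)
Definition vpoly := {mpoly R[\dim {:V}]}.

Definition vcoord (x : V) (i : 'I_(\dim {:V})) : R := coord (vbasis {:V}) i x.

Definition veval (p : vpoly) (x : V) : R := p.@[vcoord x].

(* The univariate polynomial t |-> p (t e - x); see [horner_charpoly]. *)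
Definition charpoly (p : vpoly) (e x : V) : {poly R} :=
  mmap (@polyC R) (fun i => vcoord e i *: 'X - (vcoord x i)%:P) p.

Lemma horner_charpoly p e x t : (charpoly p e x).[t] = veval p (t *: e - x).
Proof.
rewrite /charpoly /veval /meval /mmap horner_sum; apply: eq_bigr => m _.
rewrite hornerM hornerC /mmap1 horner_prod; congr (_ * _).
apply: eq_bigr => i _; rewrite horner_exp !hornerE /vcoord linearB linearZ /=.
by rewrite mulrC.
Qed.

End PolynomialsOnASpace.

Definition only_real_zeros (R : realType) (q : {poly R}) : Prop :=
  forall z : R[i], root (map_poly (real_complex R) q) z -> complex.Im z = 0.

(* The condition [hs_dir != 0] already forces V to be nonzero. *)
Record hyperbolic_system (R : realType) (V : vectType R) (n : nat) : Type :=
  HyperbolicSystem {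
    hs_poly : vpoly V;
    hs_dir : V;
    hs_dir_neq0 : hs_dir != 0;
    hs_homog : hs_poly \is n.-homog;
    hs_eval_neq0 : veval hs_poly hs_dir != 0;
    hs_real_zeros : forall x : V, only_real_zeros (charpoly hs_poly hs_dir x) }.

(* The real zeros of q, each repeated according to its multiplicity. *)
Definition zeros_mult (R : realType) (q : {poly R}) : seq R :=
  flatten [seq nseq (mup r q) r | r <- rootsR q].

Lemma perm_zeros_mult (R : realType) (c : R) (s : seq R) : c != 0 ->
  perm_eq (zeros_mult (c *: \prod_(r <- s) ('X - r%:P))) s.
Proof.
move=> c0; set q := c *: _.
have q0 : q != 0.
  by rewrite scaler_eq0 negb_or c0 monic_neq0 // monic_prod_XsubC.
have muq r : mup r q = count_mem r s.
  rewrite /q -mul_polyC mupMr ?mu_prod_XsubC //.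
  by rewrite rootC.
apply/allP => r _ /=; rewrite /zeros_mult -muq; apply/eqP.
have uroots : uniq (rootsR q) by apply: uniq_roots.
rewrite count_flatten -map_comp sumnE big_map.
have [rq|rq] := boolP (r \in rootsR q).
  rewrite (bigD1_seq r) //= count_nseq /= eqxx mul1n big1 ?addn0 //.
  by move=> r' /negPf nr; rewrite /= count_nseq /= nr.
rewrite big1_seq; last first.
  move=> r' /andP[_ r'q]; rewrite /= count_nseq /=.
  by case: eqP => // rr; rewrite -rr r'q in rq.
by rewrite mupNroot //; rewrite -roots_on_rootsR // in rq.
Qed.

Lemma real_zeros_split (R : realType) (q : {poly R}) : q != 0 ->
  only_real_zeros q ->
  q = lead_coef q *: \prod_(r <- zeros_mult q) ('X - r%:P).
Proof.
move=> q0 hq.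
have [s hs] : {s : seq R | q = lead_coef q *: \prod_(r <- s) ('X - r%:P)}.
  have [zs hz] := closed_field_poly_normal (map_poly (real_complex R) q).
  exists [seq complex.Re z | z <- zs].
  apply: (map_poly_inj (real_complex R)).
  rewrite {1}hz lead_coef_map map_polyZ rmorph_prod big_map /=; congr (_ *: _).
  apply: eq_big_seq => z zin; rewrite rmorphB /= map_polyX map_polyC /=.
  have : complex.Im z = 0.
    apply: hq; rewrite hz rootZ ?root_prod_XsubC //.
    by rewrite lead_coef_eq0 map_poly_eq0.
  by case: z {zin} => a b /= ->.
rewrite {1}hs; congr (_ *: _).
have := perm_zeros_mult s (c := lead_coef q).
rewrite lead_coef_eq0 => /(_ q0); rewrite -hs => /permP hp.
by apply/esym/perm_big/permP.
Qed.

Section Rearrangement.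
Variables (R : realType) (n : nat).

Definition decr_sort (s : seq R) : seq R := sort (fun a b => b <= a) s.

Definition decr_rearr (r : 'rV[R]_n) : seq R :=
  decr_sort [seq r 0 i | i <- enum 'I_n].

Definition top_sum (r : 'rV[R]_n) (k : nat) : R :=
  \sum_(0 <= i < k) (decr_rearr r)`_i.

Definition majorized (r s : 'rV[R]_n) : Prop :=
  (forall k : nat, (1 <= k <= n)%N -> top_sum r k <= top_sum s k)
  /\ top_sum r n = top_sum s n.

Definition eucl_norm (r : 'rV[R]_n) : R := Num.sqrt (\sum_i r 0 i ^+ 2).

End Rearrangement.

(* [zeros_mult] of the univariate polynomial has exactly n entries, so that
   [lambda] below neither truncates nor pads it. *)
Section Adequacy.
Variables (R : realType) (V : vectType R) (n : nat).
Variable H : hyperbolic_system V n.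
Implicit Type x : V.

Lemma coef_mul_top (k l : nat) (f g : {poly R}) :
  (size f <= k.+1)%N -> (size g <= l.+1)%N ->
  (size (f * g)%R <= (k + l).+1)%N /\ (f * g)`_(k + l) = f`_k * g`_l.
Proof.
move=> hf hg; split.
  by apply: leq_trans (size_polyMleq _ _) _; rewrite -subn1 leq_subLR; lia.
rewrite coefM (bigD1 (Ordinal (leq_addr l k : (k < (k + l).+1)%N))) //=.
rewrite addKn big1 ?addr0 // => i /eqP ni.
have [ik|ki|ik] := ltngtP i k.
- by rewrite [g`_ _]nth_default ?mulr0 //; apply: leq_trans hg _; lia.
- by rewrite nth_default ?mul0r //; exact: leq_trans hf _.
- by case: ni; apply: val_inj.
Qed.

Lemma charpoly_top x :
  (size (charpoly (hs_poly H) (hs_dir H) x) <= n.+1)%N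
  /\ (charpoly (hs_poly H) (hs_dir H) x)`_n = veval (hs_poly H) (hs_dir H).
Proof.
set L := fun i => vcoord (hs_dir H) i *: 'X - (vcoord x i)%:P.
have HL i k : (size (L i ^+ k)%R <= k.+1)%N
    /\ (L i ^+ k)`_k = vcoord (hs_dir H) i ^+ k.
  elim: k => [|k [IH1 IH2]]; first by rewrite !expr0 size_poly1 coef1.
  have L1 : (size (L i) <= 2)%N.
    apply/leq_sizeP => j hj; rewrite !coefE.
    by case: j hj => [|[|j]] //= _; rewrite mulr0 subr0.
  have [h1 h2] := coef_mul_top IH1 L1.
  rewrite -addn1 !exprD !expr1; split; first exact: h1.
  by rewrite h2 IH2 !coefE /= mulr1 subr0.
have HM (s : seq 'I_(\dim {:V})) (m : 'I_(\dim {:V}) -> nat) :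
    (size (\prod_(i <- s) L i ^+ m i)%R <= (\sum_(i <- s) m i).+1)%N
    /\ (\prod_(i <- s) L i ^+ m i)`_(\sum_(i <- s) m i)%N
       = \prod_(i <- s) vcoord (hs_dir H) i ^+ m i.
  elim: s => [|i s [IH1 IH2]]; first by rewrite !big_nil size_poly1 coef1.
  have [h1 h2] := coef_mul_top (HL i (m i)).1 IH1.
  by rewrite !big_cons; split=> //; rewrite h2 (HL i (m i)).2 IH2.
have HP m : m \in msupp (hs_poly H) -> (\sum_i m i)%N = n.
  by move=> mP; rewrite -mdegE; apply: (dhomogP _ _ _ (hs_homog H)) mP.
split.
  apply: leq_trans (size_sum _ _ _) _; apply/bigmax_leqP_seq => m mP _.
  rewrite mul_polyC; apply: leq_trans (size_scale_leq _ _) _.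
  by have := (HM (index_enum _) m).1; rewrite HP.
rewrite /charpoly /veval /meval /mmap coef_sum; apply: eq_big_seq => m mP.
by have := (HM (index_enum _) m).2; rewrite coefCM HP // => ->.
Qed.

Lemma charpoly_split x :
  charpoly (hs_poly H) (hs_dir H) x = veval (hs_poly H) (hs_dir H) *:
    \prod_(r <- zeros_mult (charpoly (hs_poly H) (hs_dir H) x)) ('X - r%:P)
  /\ size (zeros_mult (charpoly (hs_poly H) (hs_dir H) x)) = n.
Proof.
have [h1 h2] := charpoly_top x; have h3 := hs_eval_neq0 H.
have sz : size (charpoly (hs_poly H) (hs_dir H) x) = n.+1.
  apply/eqP; rewrite eqn_leq h1 ltnNge; apply/negP => /leq_sizeP/(_ n (leqnn _)).
  by rewrite h2 => h; rewrite h eqxx in h3.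
have q0 : charpoly (hs_poly H) (hs_dir H) x != 0 by rewrite -size_poly_eq0 sz.
have hs := real_zeros_split q0 (@hs_real_zeros _ _ _ H x).
have lc : lead_coef (charpoly (hs_poly H) (hs_dir H) x)
          = veval (hs_poly H) (hs_dir H) by rewrite lead_coefE sz.
split; first by rewrite -lc.
by move: sz; rewrite {1}hs size_scale ?lc // size_prod_XsubC => -[].
Qed.

End Adequacy.

Section HyperbolicSystems.
Variables (R : realType) (V : vectType R) (n : nat).
Variable H : hyperbolic_system V n.

Let p := hs_poly H.
Let e := hs_dir H.

Definition lambda (x : V) : 'rV[R]_n :=
  \row_(i < n) (decr_sort (zeros_mult (charpoly p e x)))`_i.

Definition hyp_cone (x : V) : Prop := forall i, 0 <= lambda x 0 i.

Definition hyp_trace (x : V) : R := \sum_i lambda x 0 i.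

Definition hyp_complete : Prop := forall x : V, lambda x = 0 -> x = 0.

Definition semi_inner (x y : V) : R :=
  4^-1 * (eucl_norm (lambda (x + y)) ^+ 2 - eucl_norm (lambda (x - y)) ^+ 2).

Definition e_doubly_stochastic (a : n.-tuple V) : Prop :=
  [/\ forall i, hyp_cone (tnth a i),
      forall i, hyp_trace (tnth a i) = 1
    & \sum_i tnth a i = e].

Definition operator_doubly_stochastic (T : V -> V) : Prop :=
  [/\ linear T,
      forall x, hyp_cone x -> hyp_cone (T x),
      T e = e
    & forall x, hyp_trace (T x) = hyp_trace x].

Definition lambda_doubly_stochastic (T : V -> V) : Prop :=
  linear T /\ forall x, majorized (lambda (T x)) (lambda x).

Definition odot (a b : n.-tuple V) (x : V) : V :=
  \sum_i semi_inner (tnth b i) x *: tnth a i.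

End HyperbolicSystems.

(* Main.v *)
Require Import Defs.
From mathcomp Require Import all_boot all_order all_fingroup all_algebra reals.
From mathcomp Require Import ring lra zify complex mpoly.
From mathcomp Require classical_sets.

(** Write sigma_k(x) for the sum of the k largest eigenvalues of x. The key
    fact is that sigma_k is subadditive. The product of the sums of eigenvalues
    over all k-subsets is a symmetric function of the eigenvalues, hence a
    polynomial in x; it is again hyperbolic with respect to e, and Garding's
    theorem (convexity of the hyperbolicity cone) applied to it gives the claim.
    Garding's theorem follows by moving univariate restrictions of p through
    polynomials without real roots, so that all roots stay in one half-plane.

    Subadditivity means that lambda(x + y) is majorized by
    lambda(x) + lambda(y), whence <x, y> <= sum_i lambda_i(x) lambda_i(y). Put
    c_i = <b_i, x>. For a set S of k indices, b_S = sum_(i in S) b_i has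
    eigenvalues in [0, 1] and trace k, so sum_(i in S) c_i = <b_S, x> is at most
    sigma_k(x). On the other side, if g is the k-th largest c_i, then
    (A o B)(x) = g e + sum_i (c_i - g) a_i and subadditivity bounds its sigma_k by
    k g + sum_i max(c_i - g, 0), the sum of the k largest c_i. *)

Set Implicit Arguments.
Unset Strict Implicit.
Unset Printing Implicit Defensive.

Import Order.TTheory GRing.Theory Num.Theory.
Import Normc.
Local Open Scope ring_scope.
Local Open Scope complex_scope.

(** * Polynomials without roots in the closed upper half-plane *)

Section HalfPlane.
Variable R : realType.
Implicit Types (z : R[i]) (f g : {poly R[i]}).

Lemma normc_ge0 z : 0 <= normc z.
Proof. by case: z => a b; apply: sqrtr_ge0. Qed.

Lemma normc_sub z w : normc (z - w) = normc (w - z).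
Proof. by rewrite -normcN opprB. Qed.

Lemma Im_le_normc z : complex.Im z <= normc z.
Proof.
case: z => a b /=; apply: le_trans (ler_norm b) _.
by rewrite -sqrtr_sqr ler_wsqrtr // lerDr sqr_ge0.
Qed.

Lemma normcX z k : normc (z ^+ k) = normc z ^+ k.
Proof. by elim: k => [|k IH]; rewrite ?normc1 // !exprS normcM IH. Qed.

Lemma normc_prod (I : Type) (s : seq I) (F : I -> R[i]) :
  normc (\prod_(i <- s) F i) = \prod_(i <- s) normc (F i).
Proof. exact: (big_morph _ (@normcM R) (normc1 R)). Qed.

Lemma le_normc_sum (I : Type) (s : seq I) (F : I -> R[i]) :
  normc (\sum_(i <- s) F i) <= \sum_(i <- s) normc (F i).
Proof.
elim: s => [|i s IH]; first by rewrite !big_nil normc0.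
by rewrite !big_cons (le_trans (le_normcD _ _)) // lerD2l.
Qed.

Lemma normc_eq0 z : (normc z == 0) = (z == 0).
Proof.
by apply/eqP/eqP => [/eq0_normc|->] //; rewrite normc0.
Qed.

Lemma normc_gt0 z : (0 < normc z) = (z != 0).
Proof. by rewrite lt0r normc_eq0 normc_ge0 andbT. Qed.

Definition lower_rooted f := forall z, 0 <= complex.Im z -> ~~ root f z.

Lemma lower_rooted_factor f : lower_rooted f -> lead_coef f != 0 /\
  exists2 rs, forall r, r \in rs -> complex.Im r < 0 &
    (size f).-1 = size rs /\
    forall z, normc f.[z] = normc (lead_coef f) * \prod_(r <- rs) normc (z - r).
Proof.
move=> hf; have f0 : lead_coef f != 0.
  rewrite lead_coef_eq0; apply/eqP => f0.
  by have := hf 0 (lexx _); rewrite f0 root0.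
split=> //; have [rs hrs] := closed_field_poly_normal f; exists rs => [r rin|].
  rewrite ltNge; apply/negP => /hf.
  by rewrite hrs rootZ // root_prod_XsubC rin.
split=> [|z]; first by rewrite hrs size_scale // size_prod_XsubC.
rewrite {1}hrs hornerZ normcM horner_prod normc_prod; congr (_ * _).
by apply: eq_bigr => r _; rewrite hornerXsubC.
Qed.

(** Each factor satisfies [1 + normc z <= k r * normc (z - r)], because
    [- complex.Im r <= normc (z - r)]. The bound is uniform up to infinity, so a small change of the
    coefficients cannot create a root anywhere in the closed half-plane. *)
Lemma lower_rooted_norm f : lower_rooted f ->
  exists2 K, 0 < K & forall z, 0 <= complex.Im z ->
    (1 + normc z) ^+ (size f).-1 <= K * normc f.[z].
Proof.
move=> /lower_rooted_factor[c0 [rs hr [szf hf]]].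
pose k (r : R[i]) : R := 1 + (1 + normc r) / - complex.Im r.
have k0 r : r \in rs -> 0 < k r.
  move=> /hr hr0; rewrite /k ltr_wpDr // divr_ge0 ?addr_ge0 ?normc_ge0 //.
  by rewrite oppr_ge0 ltW.
exists ((normc (lead_coef f))^-1 * \prod_(r <- rs) k r).
  rewrite mulr_gt0 ?invr_gt0 ?normc_gt0 //.
  by rewrite big_seq; apply/prodr_gt0 => r /k0.
move=> z hz; rewrite szf hf.
rewrite mulrACA [X in _ <= X * _]mulVf ?normc_eq0 // mul1r -big_split /=.
have -> : (1 + normc z) ^+ size rs = \prod_(r <- rs) (1 + normc z).
  by rewrite big_const_seq count_predT iter_mulr_1.
rewrite big_seq [leRHS]big_seq; apply: ler_prod => r rin.
rewrite addr_ge0 ?normc_ge0 //=.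
have hrn : - complex.Im r <= normc (z - r).
  apply: le_trans (Im_le_normc _); case: (z) (r) hz => a b [c' d'] /=; lra.
have hz' : normc z <= normc (z - r) + normc r.
  by rewrite -{1}[z](subrK r) le_normcD.
rewrite /k mulrDl mul1r mulrAC; have := hr _ rin => r0.
suff : (1 + normc r) <= (1 + normc r) * normc (z - r) / - complex.Im r by lra.
by rewrite ler_pdivlMr ?oppr_gt0 // ler_wpM2l // addr_ge0 ?normc_ge0.
Qed.

(** Every root lies below the real axis, hence at distance at least [complex.Im z] from [z]. The
    bound depends on [f] only through its leading coefficient and size, so it survives passage to a
    limit. *)
Lemma lower_rooted_lower f z : lower_rooted f -> 0 <= complex.Im z ->
  normc (lead_coef f) * complex.Im z ^+ (size f).-1 <= normc f.[z].
Proof.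
move=> /lower_rooted_factor[_ [rs hr [szf hf]]] hz; rewrite szf hf.
apply: ler_wpM2l; first exact: normc_ge0.
have -> : complex.Im z ^+ size rs = \prod_(r <- rs) complex.Im z.
  by rewrite big_const_seq count_predT iter_mulr_1.
rewrite big_seq [leRHS]big_seq; apply: ler_prod => r rin.
rewrite hz /=; apply: le_trans (Im_le_normc _).
by have := hr _ rin; case: (z) (r) => a b [c' d'] /=; lra.
Qed.

Lemma horner_real_lipschitz f (t0 : R) : exists2 M, 0 <= M &
  forall t, `|t - t0| <= 1 -> normc (f.[t%:C] - f.[t0%:C]) <= M * `|t - t0|.
Proof.
elim/poly_ind: f => [|f c [M M0 hM]].
  by exists 0 => // t _; rewrite !horner0 subrr normc0 mul0r.
have nR (a : R) : normc a%:C = `|a|.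
  by rewrite /= expr0n /= addr0 sqrtr_sqr.
exists (M * (1 + `|t0|) + normc f.[t0%:C]) => [|t ht].
  by rewrite addr_ge0 ?mulr_ge0 ?addr_ge0 ?normc_ge0.
rewrite !hornerMXaddC opprD addrACA subrr addr0.
have -> : f.[t%:C] * t%:C - f.[t0%:C] * t0%:C =
   (f.[t%:C] - f.[t0%:C]) * t%:C + f.[t0%:C] * (t - t0)%:C.
  by rewrite rmorphB /= mulrBl mulrBr addrA subrK.
apply: le_trans (le_normcD _ _) _; rewrite !normcM !nR mulrDl lerD2r.
have ht2 : `|t| <= 1 + `|t0|.
  by rewrite -{1}[t](subrK t0) (le_trans (ler_normD _ _)) // lerD2r.
rewrite mulrAC; apply: ler_pM => //; first exact: normc_ge0.
exact: hM.
Qed.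

(** The supremum of the points satisfying [P] satisfies it by closedness, and openness would push it
    further if it were below 1. *)
Lemma unit_interval_continuation (P : R -> Prop) : P 0 ->
  (forall t, 0 <= t <= 1 -> P t ->
     exists2 d, 0 < d & forall u, `|u - t| < d -> 0 <= u <= 1 -> P u) ->
  (forall t, 0 <= t <= 1 ->
     (forall d, 0 < d -> exists2 u, `|u - t| < d & 0 <= u <= 1 /\ P u) -> P t) ->
  P 1.
Proof.
move=> P0 hopen hclosed.
pose S := (fun t : R => 0 <= t <= 1 /\ P t) : classical_sets.set R.
have S0 : S 0 by rewrite /S lexx ler01.
have Sub : classical_sets.ubound S 1 by move=> t [] /andP[].
have hS : classical_sets.has_sup S by split; [exists 0 | exists 1].
have s01 : 0 <= sup S <= 1.
  rewrite (sup_upper_bound hS S0) /=.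
  rewrite leNgt; apply/negP => h1.
  have := @sup_adherent _ S (sup S - 1).
  rewrite subr_gt0 => /(_ h1 hS) [u [/andP[_ u1] _]].
  by rewrite opprB addrC subrK ltNge u1.
have Ps : P (sup S).
  apply: hclosed => // d d0; have [u Su hu] := sup_adherent d0 hS.
  exists u; last exact: Su.
  have := sup_upper_bound hS Su => hu'; rewrite ltr_norml; apply/andP; split; lra.
have [d d0 hd] := hopen _ s01 Ps.
have [h1|h1] := ltP (sup S) 1; last first.
  by have <- : sup S = 1 by apply/le_anti; rewrite h1 andbT; case/andP: s01.
pose u := Num.min (sup S + d / 2) 1.
have us : sup S < u by rewrite /u lt_min h1 ltrDl divr_gt0.
have uS : S u.
  have u01 : 0 <= u <= 1.
    by rewrite (le_trans _ (ltW us)) ?(andP s01).1 //= /u ge_min lexx orbT.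
  split=> //; apply: hd => //; rewrite ger0_norm ?subr_ge0 ?ltW //.
  rewrite ltrBlDl /u; apply: le_lt_trans (_ : sup S + d / 2 < _).
    by rewrite ge_min lexx.
  by rewrite ltrD2l; lra.
by have := sup_upper_bound hS uS; rewrite leNgt us.
Qed.

(* As t moves from 0 to 1 no root crosses the real axis. *)
Lemma lower_rooted_homotopy (B : {poly {poly R[i]}}) (c : R[i]) :
  let L t := map_poly (horner_eval t%:C) B in
  lead_coef B = c%:P -> c != 0 -> lower_rooted (L 0) ->
  (forall t s : R, 0 <= t <= 1 -> ~~ root (L t) s%:C) -> lower_rooted (L 1).
Proof.
move=> L lB c0 hL0 hreal.
have lB0 t : horner_eval t%:C (lead_coef B) != 0.
  by rewrite lB /horner_eval hornerC.
have szL t : size (L t) = size B by rewrite /L size_map_poly_id0.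
have lL t : lead_coef (L t) = c.
  by rewrite /L lead_coef_map_id0 ?lB0 ?raddf0 // lB /horner_eval hornerC.
have evL t z : (L t).[z] = B.[z%:P].[t%:C].
  have -> : z = horner_eval t%:C z%:P by rewrite /horner_eval hornerC.
  by rewrite horner_map /= /horner_eval hornerC.
apply: (@unit_interval_continuation (fun t => lower_rooted (L t))) => // t ht.
  move=> hLt; have [K K0 hK] := lower_rooted_norm hLt.
  have [M M0 hM] : exists2 M, 0 <= M & forall u, `|u - t| <= 1 ->
      \sum_(i < size B) normc ((L u)`_i - (L t)`_i) <= M * `|u - t|.
    elim: (size B) => [|k [M M0 hM]].
      by exists 0 => // u _; rewrite big_ord0 mul0r.
    have [M' M'0 hM'] := horner_real_lipschitz B`_k t.
    exists (M + M') => [|u hu]; first exact: addr_ge0.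
    rewrite big_ord_recr /= mulrDl lerD ?hM // !coef_map_id0 ?raddf0 //.
    exact: hM'.
  (* Openness. A root [z] of [L u] would force [X <= K * (M * |u - t|) * X] with [X] a positive
     power of [1 + normc z]; this radius makes the factor less than 1. The bound [M] is valid only
     within distance 1, and [M + 1] avoids inverting 0. *)
  exists (Num.min 1 (K * (M + 1))^-1) => [|u].
    by rewrite lt_min ltr01 invr_gt0 mulr_gt0 // ltr_wpDl.
  rewrite lt_min => /andP[hu1 hu2] hu z hz; apply/negP => /rootP fz.
  have h2 := hM _ (ltW hu1); have := hK z hz.
  rewrite szL -[(L t).[z]]subr0 -fz normc_sub => h1.
  have h3 : normc ((L u).[z] - (L t).[z]) <=
      (\sum_(i < size B) normc ((L u)`_i - (L t)`_i)) * (1 + normc z) ^+ (size B).-1.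
    rewrite (horner_coef_wide _ (eq_leq (szL u))) (horner_coef_wide _ (eq_leq (szL t))).
    rewrite -sumrB mulr_suml; apply: le_trans (le_normc_sum _ _) _.
    apply: ler_sum => i _; rewrite -mulrBl normcM normcX ler_wpM2l ?normc_ge0 //.
    have z1 : 1 <= 1 + normc z by rewrite lerDl normc_ge0.
    apply: le_trans (_ : (1 + normc z) ^+ i <= _).
      by rewrite lerXn2r ?nnegrE ?addr_ge0 ?normc_ge0 // lerDr.
    by rewrite ler_weXn2l //; case: (size B) i => [[]|k i] //; rewrite -ltnS ltn_ord.
  set X := (1 + normc z) ^+ _ in h1 h3.
  have X0 : 0 < X by rewrite exprn_gt0 // ltr_pwDl ?normc_ge0.
  have h4 : X <= K * (M * `|u - t|) * X.
    apply: le_trans h1 _; rewrite -mulrA (ler_wpM2l (ltW K0)) //.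
    by apply: le_trans h3 _; rewrite (ler_wpM2r (ltW X0)).
  have : K * (M * `|u - t|) < 1.
    have KM0 : 0 < K * (M + 1) by rewrite mulr_gt0 // ltr_wpDl.
    apply: le_lt_trans (_ : K * (M + 1) * `|u - t| < _).
      by rewrite mulrA ler_wpM2r // (ler_wpM2l (ltW K0)) // lerDl.
    by rewrite -ltr_pdivlMl // mulr1.
  by rewrite ltNge -(ler_pM2r X0) mul1r h4.
(* Closedness. Real points are excluded by hypothesis. Above the axis, nearby lower-rooted [L u]
   share the positive lower bound [y] at [z], as size and leading coefficient do not depend on [u];
   continuity then forbids [(L t).[z] = 0]. *)
move=> hnear z; rewrite le_eqVlt => /orP[/eqP z0|z0].
  have -> : z = (complex.Re z)%:C by case: z z0 => a b /= <-.
  exact: hreal.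
apply/negP => /rootP; rewrite evL => fz.
have [M M0 hM] := horner_real_lipschitz B.[z%:P] t.
set y := normc c * complex.Im z ^+ (size B).-1.
have y0 : 0 < y.
  by rewrite mulr_gt0 ?exprn_gt0 // normc_gt0.
have d0 : 0 < Num.min 1 (y / (M + 1)).
  by rewrite lt_min ltr01 divr_gt0 // ltr_wpDl.
have [u] := hnear _ d0; rewrite lt_min => /andP[hu1 hu2] [hu hLu].
have := lower_rooted_lower hLu (ltW z0); rewrite lL szL -/y leNgt => /negP; apply.
have := hM _ (ltW hu1); rewrite fz subr0 -evL => h; apply: le_lt_trans h _.
rewrite ltr_pdivlMr ?ltr_wpDl // in hu2; apply: le_lt_trans hu2.
by rewrite [leRHS]mulrC ler_wpM2r // lerDl.
Qed.

End HalfPlane.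

(** * Garding's theorem *)

Section PolynomialMaps.
Variables (d : nat) (R A : comNzRingType).
Implicit Type p : {mpoly R[d]}.

Lemma rmorph_mmap (S : comNzRingType) (g : {rmorphism A -> S}) (f : R -> A)
    (v : 'I_d -> A) p :
  g (mmap f v p) = mmap (g \o f) (g \o v) p.
Proof.
rewrite /mmap rmorph_sum /=; apply: eq_bigr => m _; rewrite rmorphM /mmap1.
by rewrite rmorph_prod; congr (_ * _); apply: eq_bigr => i _; rewrite rmorphXn.
Qed.

Lemma eq_mmap (f g : R -> A) (u v : 'I_d -> A) p :
  f =1 g -> u =1 v -> mmap f u p = mmap g v p.
Proof.
move=> fg uv; rewrite /mmap; apply: eq_bigr => m _.
by rewrite fg (mmap1_eq m uv).
Qed.

Lemma mmap_homogZ (f : R -> A) (v : 'I_d -> A) k p (c : A) :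
  p \is k.-homog -> mmap f (fun i => c * v i) p = c ^+ k * mmap f v p.
Proof.
move=> hp; rewrite /mmap mulr_sumr; apply: eq_big_seq => m mp.
rewrite mulrCA; congr (_ * _); rewrite /mmap1.
rewrite (eq_bigr (fun i => c ^+ m i * v i ^+ m i)) => [|i _]; last exact: exprMn.
by rewrite big_split /= -expr_sum -mdegE (dhomogP _ _ _ hp _ mp).
Qed.

(** The general coefficient ring is needed because [A] will itself be a polynomial ring in the
    homotopy parameter. *)
Lemma mulrp_top (k l : nat) (f g : {poly A}) :
  (size f <= k.+1)%N -> (size g <= l.+1)%N ->
  (size (f * g)%R <= (k + l).+1)%N /\ (f * g)`_(k + l) = f`_k * g`_l.
Proof.
move=> hf hg; split.
  by apply: leq_trans (size_polyMleq _ _) _; rewrite -subn1 leq_subLR; lia.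
have hk : (k < (k + l).+1)%N by rewrite ltnS leq_addr.
rewrite coefM (bigD1 (Ordinal hk)) //= addKn big1 ?addr0 // => i.
rewrite -val_eqE /= neq_ltn => /orP[ik|ki].
  by rewrite [g`_ _]nth_default ?mulr0 //; apply: leq_trans hg _; lia.
by rewrite nth_default ?mul0r //; exact: leq_trans hf _.
Qed.

(** A monomial of degree [k] becomes a product of [k] factors [u_i + w_i X], whose top coefficient
    is the same monomial in [w]. *)
Lemma mmap_line_top (f : R -> A) (u w : 'I_d -> A) k p : p \is k.-homog ->
  let q := mmap (@polyC A \o f) (fun i => (u i)%:P + w i *: 'X) p in
  (size q <= k.+1)%N /\ q`_k = mmap f w p.
Proof.
move=> hp /=; set L := fun i => _.
have L1 i : (size (L i) <= 2)%N /\ (L i)`_1 = w i.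
  rewrite /L; split; last by rewrite !coefE /= mulr1 add0r.
  apply/leq_sizeP => -[|[|j]] // _.
  by rewrite !coefE /= mulr0 addr0.
have HL i j : (size (L i ^+ j)%R <= j.+1)%N /\ (L i ^+ j)`_j = w i ^+ j.
  elim: j => [|j [IH1 IH2]]; first by rewrite !expr0 size_poly1 coef1.
  have [h1 h2] := mulrp_top (L1 i).1 IH1.
  by rewrite -add1n !exprD !expr1; split=> //; rewrite h2 IH2 (L1 i).2.
have HM (s : seq 'I_d) (m : 'X_{1..d}) :
    (size (\prod_(i <- s) L i ^+ m i)%R <= (\sum_(i <- s) m i).+1)%N
    /\ (\prod_(i <- s) L i ^+ m i)`_(\sum_(i <- s) m i)%N
       = \prod_(i <- s) w i ^+ m i.
  elim: s => [|i s [IH1 IH2]]; first by rewrite !big_nil size_poly1 coef1.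
  have [h1 h2] := mulrp_top (HL i (m i)).1 IH1.
  by rewrite !big_cons; split=> //; rewrite h2 (HL i (m i)).2 IH2.
have HP m : m \in msupp p -> (\sum_i m i)%N = k.
  by move=> mp; rewrite -mdegE; apply: (dhomogP _ _ _ hp).
split.
  apply: leq_trans (size_sum _ _ _) _; apply/bigmax_leqP_seq => m mp _.
  rewrite /= mul_polyC; apply: leq_trans (size_scale_leq _ _) _.
  by have := (HM (index_enum _) m).1; rewrite HP.
rewrite /mmap coef_sum; apply: eq_big_seq => m mp.
by have := (HM (index_enum _) m).2; rewrite coefCM HP // => ->.
Qed.

End PolynomialMaps.

Section Garding.
Variables (R : realType) (d n : nat) (p : {mpoly R[d]}).
Hypothesis hp : p \is n.-homog.
Implicit Types (x y : 'I_d -> R) (v : 'I_d -> R[i]).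

Let ceval v : R[i] := mmap (real_complex R) v p.

Lemma ceval_real x : ceval (fun i => (x i)%:C) = (p.@[x])%:C.
Proof. by rewrite /meval rmorph_mmap. Qed.

(** Real-rootedness in direction [e]. Taking [x = 0] and [t = 'i] also yields that [p] does not
    vanish at [e], by homogeneity. *)
Definition nonreal_hyperbolic (e : 'I_d -> R) := forall x (t : R[i]),
  complex.Im t != 0 -> ceval (fun i => (x i)%:C + t * (e i)%:C) != 0.

(** For hyperbolic [p] this is the open hyperbolicity cone: all roots of [t |-> p(y + t e)] are
    negative. *)
Definition ray_cone (e y : 'I_d -> R) := forall t : R, 0 <= t ->
  p.@[fun i => y i + t * e i] != 0.

Lemma halfplane_homotopy (u v w : 'I_d -> R[i]) : ceval w != 0 ->
  (forall s, 0 <= complex.Im s -> ceval (fun i => u i + s * w i) != 0) ->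
  (forall t s : R, 0 <= t <= 1 ->
     ceval (fun i => u i + t%:C * v i + s%:C * w i) != 0) ->
  forall s, 0 <= complex.Im s -> ceval (fun i => u i + v i + s * w i) != 0.
Proof.
move=> w0 h0 hreal.
(* The outer variable stands for [s], the inner one for [t]. By homogeneity the coefficient of [s^n]
   is the value of [p] at [w], which is constant in [t], so the degree in [s] never drops. *)
pose B : {poly {poly R[i]}} :=
  mmap (@polyC _ \o (@polyC _ \o real_complex R))
    (fun i => ((u i)%:P + v i *: 'X)%:P + (w i)%:P *: 'X) p.
have [B1 B2] := mmap_line_top (@polyC _ \o real_complex R)
  (fun i => (u i)%:P + v i *: 'X) (fun i => (w i)%:P) hp.
have {}B2 : B`_n = (ceval w)%:P by rewrite B2 /ceval rmorph_mmap.
have lB : lead_coef B = (ceval w)%:P.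
  have szB : size B = n.+1.
    apply/eqP; rewrite eqn_leq B1 ltnNge; apply/negP => /leq_sizeP/(_ n (leqnn _)).
    by rewrite B2 => /eqP; rewrite polyC_eq0 (negPf w0).
  by rewrite lead_coefE szB.
have evB (t : R) s : (map_poly (horner_eval t%:C) B).[s] =
    ceval (fun i => u i + t%:C * v i + s * w i).
  rewrite -/(horner_eval s _) /B !rmorph_mmap; apply: eq_mmap => [a|i] /=.
    by rewrite map_polyC /= /horner_eval !hornerC.
  rewrite rmorphD /= map_polyZ map_polyC map_polyX /= /horner_eval !hornerE.
  by rewrite [t%:C * _]mulrC [s * _]mulrC.
have ceq (f g : 'I_d -> R[i]) : f =1 g -> ceval f = ceval g by exact: eq_mmap.
have h s : 0 <= complex.Im s -> ~~ root (map_poly (horner_eval 1%:C) B) s.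
  apply: (lower_rooted_homotopy lB w0) => [{}s hs|t {}s ht].
    rewrite rootE evB (ceq _ (fun i => u i + s * w i)) ?h0 // => i.
    by rewrite mul0r addr0.
  by rewrite rootE evB hreal.
move=> s /h; rewrite rootE evB.
by rewrite (ceq _ (fun i => u i + v i + s * w i)) // => i; rewrite mul1r.
Qed.

Section Cone.
Variable e : 'I_d -> R.
Hypothesis hyp : nonreal_hyperbolic e.

Let ceq (f g : 'I_d -> R[i]) : f =1 g -> ceval f = ceval g.
Proof. exact: eq_mmap. Qed.

Let ceqn (f g : 'I_d -> R[i]) : f =1 g -> ceval f != 0 -> ceval g != 0.
Proof. by move=> /ceq ->. Qed.

Let cevalZ (c : R[i]) (f g : 'I_d -> R[i]) : (forall i, g i = c * f i) ->
  ceval g = c ^+ n * ceval f.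
Proof. by move=> /ceq ->; apply: mmap_homogZ. Qed.

(** For [s] nonzero, homogeneity reduces the claim to [p(y + (i/s) e)]. Either [i/s] is not real and
    hyperbolicity applies, or it is real, and then nonnegative because [complex.Im s >= 0], so the
    cone condition applies. *)
Lemma ceval_cone y s : ray_cone e y -> 0 <= complex.Im s ->
  ceval (fun i => 'i * (e i)%:C + s * (y i)%:C) != 0.
Proof.
move=> hy hs; have [s0|s0] := eqVneq s 0.
  apply: ceqn (@hyp (fun _ => 0) 'i (oner_neq0 _)) => i.
  by rewrite s0 rmorph0 add0r mul0r addr0.
have -> : ceval (fun i => 'i * (e i)%:C + s * (y i)%:C) =
    s ^+ n * ceval (fun i => (y i)%:C + 'i / s * (e i)%:C).
  apply: cevalZ => i.
  by rewrite mulrDr addrC mulrA mulrCA mulfV // mulr1.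
rewrite mulf_neq0 ?expf_neq0 //.
have [im0|] := eqVneq (complex.Im ('i / s)) 0; last exact: hyp.
pose t := complex.Re ('i / s); have ht : 'i / s = t%:C.
  by rewrite /t; move: im0; case: ('i / s) => a b /= ->.
have t0 : 0 <= t.
  have : t%:C * s = 'i by rewrite -ht mulfVK.
  case: (s) hs => a b /= hb /eqP; rewrite eq_complex /= => /andP[_ /eqP].
  rewrite mul0r addr0 => tb; rewrite leNgt; apply/negP => t0.
  by have := mulr_le0_ge0 (ltW t0) hb; rewrite tb ler10.
rewrite ht (@ceq _ (fun i => (y i + t * e i)%:C)).
  by rewrite ceval_real -(rmorph0 (real_complex R)) (inj_eq (@complexI _)) hy.
by move=> i; rewrite rmorphD rmorphM.
Qed.

Lemma ray_cone_real y : ray_cone e y -> ceval (fun i => (y i)%:C) != 0.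
Proof.
move=> /(_ 0 (lexx _)); rewrite ceval_real -(rmorph0 (real_complex R)).
rewrite (inj_eq (@complexI _)); congr (_ != _); apply: meval_eq => i.
by rewrite mul0r addr0.
Qed.

(* Two homotopies: first from p(ie + sy) to p(ie + z + sy), for real z, then
   from p(ie + sx) to p(ie + iy + sx); evaluate at s = i and divide by i^n. *)
Lemma garding_aux x y : ray_cone e x -> ray_cone e y ->
  p.@[fun i => e i + x i + y i] != 0.
Proof.
move=> hx hy.
have step1 (z : 'I_d -> R) s : 0 <= complex.Im s ->
    ceval (fun i => 'i * (e i)%:C + (z i)%:C + s * (y i)%:C) != 0.
  apply: halfplane_homotopy => [|s' hs'|t s' ht]; first exact: ray_cone_real.
    exact: ceval_cone.
  apply: ceqn (@hyp (fun i => t * z i + s' * y i) 'i (oner_neq0 _)) => i.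
  by rewrite rmorphD !rmorphM /= addrC addrA.
have : ceval (fun i => 'i * (e i)%:C + 'i * (y i)%:C + 'i * (x i)%:C) != 0.
  apply: halfplane_homotopy (ler01 : 0 <= complex.Im 'i) => [|s hs|t s /andP[t0 _]].
  - exact: ray_cone_real.
  - exact: ceval_cone.
  have ht : 0 <= complex.Im (t%:C * 'i) by rewrite /= mul0r mulr1 addr0.
  apply: ceqn (@step1 (fun i => s * x i) _ ht) => i.
  by rewrite rmorphM /= addrAC mulrA.
have -> : ceval (fun i => 'i * (e i)%:C + 'i * (y i)%:C + 'i * (x i)%:C) =
    'i ^+ n * (p.@[fun i => e i + x i + y i])%:C.
  rewrite -ceval_real; apply: cevalZ => i.
  by rewrite !rmorphD /= !mulrDr addrAC.
by apply: contraNneq => ->; rewrite rmorph0 mulr0.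
Qed.

End Cone.

(** This is [garding_aux] with [t * e] in place of [e]: rescaling by a positive factor preserves
    hyperbolicity and the cone. *)
Lemma garding e x y : nonreal_hyperbolic e -> ray_cone e x -> ray_cone e y ->
  forall t : R, 0 < t -> p.@[fun i => x i + y i + t * e i] != 0.
Proof.
move=> he hx hy t t0.
have := @garding_aux (fun i => t * e i) _ x y.
rewrite (meval_eq _ (v2 := fun i => x i + y i + t * e i)) => [|i]; last first.
  by rewrite -addrA addrC.
apply.
- move=> z s hs; have := @he z (s * t%:C); rewrite /ceval.
  rewrite (eq_mmap _ (f := real_complex R) (g := real_complex R)
    (v := fun i => (z i)%:C + s * (t * e i)%:C)) //; last first.
    by move=> i; rewrite rmorphM /= mulrA.
  apply; case: (s) hs => a b /= hb.
  by rewrite mulr0 add0r mulf_neq0 // gt_eqF.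
- move=> s s0; have := hx (s * t) (mulr_ge0 s0 (ltW t0)).
  by congr (_ != _); apply: meval_eq => i; rewrite mulrA.
- move=> s s0; have := hy (s * t) (mulr_ge0 s0 (ltW t0)).
  by congr (_ != _); apply: meval_eq => i; rewrite mulrA.
Qed.

End Garding.

(** * Symmetric functions of the eigenvalues *)

Lemma horner_inj (R : numDomainType) (f g : {poly R}) :
  (forall t, f.[t] = g.[t]) -> f = g.
Proof.
move=> fg; apply/eqP; rewrite -subr_eq0; apply/negPn/negP => h0.
have := max_poly_roots h0 (rs := [seq i%:R | i <- iota 0 (size (f - g))]).
rewrite size_map size_iota ltnn => h.
suff : false by []; apply: h.
  by apply/allP => _ /mapP[i _ ->]; rewrite rootE hornerD hornerN fg subrr.
rewrite map_inj_uniq ?iota_uniq // => i j /eqP.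
by rewrite eqr_nat => /eqP.
Qed.

Section CoefficientWeight.
Variables (d : nat) (A : comNzRingType).

(** Joint homogeneity of degree [k] in the [d] variables and the polynomial variable, read off
    coefficientwise. The vanishing clause compensates for truncated subtraction, which makes [k - j]
    equal to 0 for every [j > k]. *)
Definition weighted (k : nat) (f : {poly {mpoly A[d]}}) := forall j,
  (f`_j \is (k - j).-homog) /\ ((k < j)%N -> f`_j = 0).

Lemma weightedM k l f g : weighted k f -> weighted l g -> weighted (k + l) (f * g).
Proof.
move=> hf hg j; rewrite coefM; split=> [|hj].
  apply: rpred_sum => i _.
  have [ki|ik] := ltnP k i; first by rewrite (hf i).2 // mul0r rpred0.
  have [kj|jk] := ltnP l (j - i); first by rewrite (hg _).2 // mulr0 rpred0.
  have ij := ltn_ord i.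
  have -> : (k + l - j = (k - i) + (l - (j - i)))%N by lia.
  by apply: dhomogM; [exact: (hf i).1 | exact: (hg _).1].
apply: big1 => i _; have [ki|ik] := ltnP k i; first by rewrite (hf i).2 // mul0r.
by rewrite (hg _).2 ?mulr0 //; have := ltn_ord i; lia.
Qed.

Lemma weighted1 : weighted 0 1.
Proof.
move=> j; rewrite coef1; case: j => [|j]; split=> //=; first exact: dhomog1.
exact: rpred0.
Qed.

Lemma weightedX k f m : weighted k f -> weighted (k * m) (f ^+ m).
Proof.
move=> hf; elim: m => [|m IH]; first by rewrite muln0; exact: weighted1.
by rewrite exprS mulnS; apply: weightedM.
Qed.

Lemma dhomogC (c : A) : (c%:MP : {mpoly A[d]}) \is 0.-homog.
Proof. by rewrite -[c%:MP]mulr1 mul_mpolyC; apply/rpredZ/dhomog1. Qed.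

Lemma weighted_mmap (f : A -> {poly {mpoly A[d]}}) (p : {mpoly A[d]}) k
    (h : 'I_d -> {poly {mpoly A[d]}}) : p \is k.-homog ->
  (forall i, weighted 1 (h i)) -> (forall a, weighted 0 (f a)) ->
  weighted k (mmap f h p).
Proof.
move=> hp hh hf.
have hm m : m \in msupp p -> weighted k (f p@_m * mmap1 h m).
  move=> mp; rewrite -[k]add0n; apply: weightedM => //.
  have <- : (\sum_i m i)%N = k by rewrite -mdegE; exact: (dhomogP _ _ _ hp).
  rewrite /mmap1.
  elim: (index_enum _) => [|i s IH]; first by rewrite !big_nil; exact: weighted1.
  rewrite !big_cons; apply: weightedM => //.
  by have := weightedX (m i) (hh i); rewrite mul1n.
move=> j; rewrite /mmap coef_sum; split=> [|hj].
  by rewrite big_seq; apply: rpred_sum => m /hm /(_ j) [].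
by rewrite big_seq big1 // => m /hm /(_ j) [_ ->].
Qed.

End CoefficientWeight.

Section SymmetricFunctions.
Variables (R : realType) (V : vectType R) (n : nat) (H : hyperbolic_system V n).
Local Notation p := (hs_poly H).
Local Notation e := (hs_dir H).
Local Notation lam := (lambda H).
Implicit Types x y : V.

Lemma size_zeros x : size (zeros_mult (charpoly p e x)) = n.
Proof. by have [] := charpoly_split H x. Qed.

Lemma lambda_seq x :
  [seq lam x 0 i | i <- enum 'I_n] = decr_sort (zeros_mult (charpoly p e x)).
Proof.
apply: (@eq_from_nth _ 0); first by rewrite size_map size_enum_ord size_sort size_zeros.
move=> i; rewrite size_map size_enum_ord => hi.
by rewrite (nth_map (Ordinal hi)) ?size_enum_ord // mxE nth_enum_ord.
Qed.

Lemma charpoly_lambda x :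
  charpoly p e x = veval p e *: \prod_i ('X - (lam x 0 i)%:P).
Proof.
rewrite {1}(charpoly_split H x).1; congr (_ *: _).
have -> : \prod_i ('X - (lam x 0 i)%:P) =
    \prod_(r <- [seq lam x 0 i | i <- enum 'I_n]) ('X - r%:P).
  by rewrite big_map big_enum.
by rewrite lambda_seq; apply/esym/perm_big; rewrite perm_sort.
Qed.

Lemma veval_lambda x t :
  veval p (t *: e - x) = veval p e * \prod_i (t - lam x 0 i).
Proof.
rewrite -horner_charpoly charpoly_lambda hornerZ horner_prod; congr (_ * _).
by apply: eq_bigr => i _; rewrite hornerXsubC.
Qed.

Lemma lambda_decr x (i j : 'I_n) : (i <= j)%N -> lam x 0 j <= lam x 0 i.
Proof.
move=> ij; rewrite !mxE; set s := decr_sort _.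
have hs : sorted (fun a b : R => b <= a) s.
  by apply: sort_sorted => a b; apply: le_total.
have tr : transitive (fun a b : R => b <= a).
  by move=> a b c ba ac; apply: le_trans ac ba.
by apply: (sorted_leq_nth tr _ _ hs) => //; rewrite inE size_sort size_zeros.
Qed.

Lemma perm_lambda x (f : 'I_n -> R) :
  (forall t, veval p (t *: e - x) = veval p e * \prod_i (t - f i)) ->
  perm_eq [seq lam x 0 i | i <- enum 'I_n] [seq f i | i <- enum 'I_n].
Proof.
move=> hf; rewrite lambda_seq perm_sort.
have -> : charpoly p e x =
    veval p e *: \prod_(r <- [seq f i | i <- enum 'I_n]) ('X - r%:P).
  apply: horner_inj => t; rewrite horner_charpoly hf hornerZ horner_prod big_map.
  by rewrite big_enum; congr (_ * _); apply: eq_bigr => i _; rewrite hornerXsubC.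
exact: perm_zeros_mult (hs_eval_neq0 H).
Qed.

(** Up to sign and the factor [p(e)], this elementary symmetric function is the coefficient of
    [t^(n-k)] in [p(t e - x)], which is a form of degree [k] in [x]. *)
Lemma mesym_lambda k : (k <= n)%N -> exists2 Q : vpoly V, Q \is k.-homog &
  forall x, veval Q x = (mesym n R k).@[fun i => lam x 0 i].
Proof.
move=> kn.
(* The generic characteristic polynomial: the coordinates of [x] are kept as indeterminates. *)
pose P : {poly {mpoly R[\dim {:V}]}} := mmap (@polyC _ \o @mpolyC _ R)
  (fun i => (vcoord e i)%:MP *: 'X - ('X_i)%:P) p.
have wP : weighted n P.
  apply: weighted_mmap (hs_homog H) _ _ => [i j|a j]; last first.
    rewrite /= coefC; case: j => [|j]; split=> //=; last exact: rpred0.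
    exact: dhomogC.
  rewrite coefB coefZ coefX coefC; case: j => [|[|j]] /=; split=> //.
  - by rewrite mulr0 add0r rpredN dhomogX /= mdeg1.
  - by rewrite mulr1 subr0; exact: dhomogC.
  - by rewrite mulr0 subr0 rpred0.
  - by rewrite mulr0 subr0.
exists ((-1) ^+ k * (veval p e)^-1 *: P`_(n - k)).
  by apply: rpredZ; have := (wP (n - k)%N).1; rewrite subKn.
move=> x; rewrite /veval mevalZ.
have -> : (P`_(n - k)).@[vcoord x] = (charpoly p e x)`_(n - k).
  suff <- : map_poly (meval (vcoord x)) P = charpoly p e x by rewrite coef_map.
  rewrite /P rmorph_mmap; apply: eq_mmap => [a|i] /=.
    by rewrite map_polyC /= mevalC.
  by rewrite rmorphB /= map_polyZ map_polyX map_polyC /= mevalC mevalXU.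
rewrite charpoly_lambda coefZ -/(veval p e).
rewrite -mulrA mulKf ?hs_eval_neq0 //.
have -> : \prod_i ('X - (lam x 0 i)%:P) =
    \prod_(c <- [tuple lam x 0 i | i < n]) ('X - c%:P).
  by rewrite big_tuple; apply: eq_bigr => i _; rewrite tnth_mktuple.
have -> : (n - k = n - Ordinal (kn : (k < n.+1)%N))%N by [].
rewrite mroots_coeff /= mulrA -exprD addnn -muln2 mulnC exprM sqrrN !expr1n mul1r.
by apply: meval_eq => i; rewrite tnth_mktuple.
Qed.

(** Write [g] as a polynomial [t] in the elementary symmetric polynomials and substitute the forms
    of [mesym_lambda]. Since [t] has weighted degree [k], with variable [i] of weight [i + 1], the
    result is a form of degree [k]. *)
Lemma symmetric_lambda (g : {mpoly R[n]}) k : g \is symmetric -> g \is k.-homog ->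
  exists2 Q : vpoly V, Q \is k.-homog &
    forall x, veval Q x = g.@[fun i => lam x 0 i].
Proof.
move=> gsym ghom; have [t [<- ht]] := sym_fundamental_homog gsym ghom.
pose good (i : 'I_n) Q := Q \is i.+1.-homog /\
  forall x, veval (Q : vpoly V) x = (mesym n R i.+1).@[fun j => lam x 0 j].
have [i|Q hQ] := @fin_all_exists _ (fun=> vpoly V) good.
  by have [Q h1 h2] := mesym_lambda (ltn_ord i); exists Q.
exists (t \mPo [tuple Q i | i < n]).
  rewrite comp_mpolyEX; rewrite big_seq; apply: rpred_sum => m mt; apply: rpredZ.
  rewrite comp_mpolyX -(dhomogP _ _ _ ht _ mt) /= /mnmwgt.
  elim: (index_enum _) => [|i s IH]; first by rewrite !big_nil dhomog1.
  rewrite !big_cons; apply: dhomogM => //; rewrite tnth_mktuple mulnC.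
  by apply: dhomogMn; case: (hQ i).
move=> x; rewrite /veval !comp_mpoly_meval; apply: meval_eq => i.
by rewrite !tnth_mktuple; apply: (hQ i).2.
Qed.

End SymmetricFunctions.

(** * Quadratic forms and sums of the largest entries *)

Section LinearAndQuadraticForms.
Variables (R : realType) (d : nat).
Implicit Types (Q : {mpoly R[d]}) (u v w : 'I_d -> R).

Lemma meval_mmap1 Q v : Q.@[v] = \sum_(m <- msupp Q) Q@_m * mmap1 v m.
Proof. by rewrite mevalE. Qed.

Lemma linear_form Q (a : R) u v w : Q \is 1.-homog ->
  (forall i, w i = a * u i + v i) -> Q.@[w] = a * Q.@[u] + Q.@[v].
Proof.
move=> hQ hw; rewrite !meval_mmap1 mulr_sumr -big_split /=.
apply: eq_big_seq => m mQ; have /eqP := dhomogP _ _ _ hQ _ mQ.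
by move=> /mdeg1P[i /eqP ->]; rewrite !mmap1U hw; ring.
Qed.

Lemma mdeg2_split (m : 'X_{1..d}) : mdeg m = 2%N ->
  exists i j, m = (U_(i) + U_(j))%MM.
Proof.
move=> hm; have [i mi] : exists i, m i != 0%N.
  apply/existsP; rewrite -negb_forall; apply/negP => /forallP h0.
  by move: hm; rewrite mdegE big1 // => i _; apply/eqP; rewrite (eqP (h0 i)).
have hi : (U_(i) <= m)%MM.
  apply/mnm_lepP => j; rewrite mnm1E; case: eqP => // <-.
  by rewrite lt0n.
have /eqP : mdeg (m - U_(i))%MM = 1%N.
  by apply/eqP; rewrite -eqSS -hm -{2}(submK hi) mdegD mdeg1 addn1.
by move=> /mdeg1P[j /eqP hj]; exists j, i; rewrite -hj submK.
Qed.

Lemma mmap1_mdeg2 (m : 'X_{1..d}) : mdeg m = 2%N ->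
  exists i j, forall v : 'I_d -> R, mmap1 v m = v i * v j.
Proof.
move=> /mdeg2_split[i [j ->]]; exists i, j => v.
by rewrite commr_mmap1_M ?mmap1U // => k x; apply: mulrC.
Qed.

(** On a monomial of indices [i], [j] the difference is [2 * (x i * w j + w i * x j)], which is
    linear in [w]. *)
Lemma quadratic_form_polar Q (a : R) x u v : Q \is 2.-homog ->
  let B w := Q.@[fun i => x i + w i] - Q.@[fun i => x i - w i] in
  B (fun i => a * u i + v i) = a * B u + B v.
Proof.
move=> hQ /=; rewrite !meval_mmap1 -!sumrB mulr_sumr -big_split /=.
apply: eq_big_seq => m mQ; have := dhomogP _ _ _ hQ _ mQ.
by move=> /= /mmap1_mdeg2[i [j hm]]; rewrite !hm; ring.
Qed.

Lemma quadratic_formD Q u v : Q \is 2.-homog ->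
  Q.@[fun i => u i + v i] =
  Q.@[u] + Q.@[v] + 2^-1 * (Q.@[fun i => u i + v i] - Q.@[fun i => u i - v i]).
Proof.
move=> hQ; rewrite !meval_mmap1 -sumrB mulr_sumr -!big_split /=.
apply: eq_big_seq => m mQ; have := dhomogP _ _ _ hQ _ mQ.
by move=> /= /mmap1_mdeg2[i [j hm]]; rewrite !hm; field.
Qed.

End LinearAndQuadraticForms.

Section TopSums.
Variables (R : realType) (n : nat).
Implicit Types (f w : 'I_n -> R).

Lemma card_ord_lt k : (k <= n)%N -> #|[set i : 'I_n | (i < k)%N]| = k.
Proof.
move=> kn; rewrite -sum1_card.
have -> : \sum_(i in [set i : 'I_n | (i < k)%N]) 1%N = \sum_(i < n | (i < k)%N) 1%N.
  by apply: eq_bigl => i; rewrite inE.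
by rewrite -(big_ord_widen n (fun=> 1%N)) // sum1_card card_ord.
Qed.

Lemma sumr_ord_lt_const (k : nat) (c : R) : (k <= n)%N ->
  \sum_(i < n | (i < k)%N) c = k%:R * c.
Proof.
move=> kn; rewrite -[in RHS](card_ord_lt kn) sumr_const mulr_natl.
by congr (_ *+ _); apply: eq_card => i; rewrite inE.
Qed.

(** Subtract the [k]-th entry [c] from all of [f]: the first [k] terms become nonnegative, so
    weights at most 1 only lower them, and the others become nonpositive. *)
Lemma weighted_sum_le_top f w k :
  (forall i j : 'I_n, (i <= j)%N -> f j <= f i) ->
  (forall i, 0 <= w i <= 1) -> (k <= n)%N -> \sum_i w i = k%:R ->
  \sum_i w i * f i <= \sum_(i < n | (i < k)%N) f i.
Proof.
move=> fd w01 kn wk.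
(* With [k = 0] there is no [k]-th entry; the nonnegative weights sum to 0 and all vanish. *)
case: k kn wk => [|k] kn wk.
  rewrite [leRHS]big_pred0 // big1 // => i _.
  suff -> : w i = 0 by rewrite mul0r.
  apply/le_anti; rewrite (andP (w01 i)).1 andbT -[X in _ <= X]wk.
  by rewrite (bigD1 i) //= lerDl sumr_ge0 // => j _; case/andP: (w01 j).
pose c := f (Ordinal kn).
have h1 : \sum_(i < n | (i < k.+1)%N) (f i - c) =
    \sum_(i < n | (i < k.+1)%N) f i - k.+1%:R * c.
  by rewrite sumrB sumr_ord_lt_const.
have h2 : \sum_i w i * (f i - c) = \sum_i w i * f i - k.+1%:R * c.
  by rewrite -wk mulr_suml -sumrB; apply: eq_bigr => i _; rewrite mulrBr.
suff : \sum_i w i * (f i - c) <= \sum_(i < n | (i < k.+1)%N) (f i - c).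
  by rewrite h1 h2 lerD2r.
rewrite [leRHS]big_mkcond /=; apply: ler_sum => i _.
have /andP[w0 w1] := w01 i; case: ltnP => ik.
  by rewrite ler_piMl // subr_ge0 fd.
by rewrite mulr_ge0_le0 // subr_le0 fd //= ltnW.
Qed.

Lemma subset_sum_le_top f (S : {set 'I_n}) :
  (forall i j : 'I_n, (i <= j)%N -> f j <= f i) ->
  \sum_(i in S) f i <= \sum_(i < n | (i < #|S|)%N) f i.
Proof.
move=> fd; pose w i : R := (i \in S)%:R.
have := @weighted_sum_le_top f w #|S| fd.
have -> : \sum_i w i * f i = \sum_(i in S) f i.
  rewrite [RHS]big_mkcond; apply: eq_bigr => i _; rewrite /w.
  by case: ifP; rewrite ?mul1r ?mul0r.
apply => [i||].
- by rewrite /w; case: (i \in S); rewrite ?lexx ?ler01.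
- by rewrite -[X in (_ <= X)%N]card_ord max_card.
- by rewrite /w -natr_sum -big_mkcond sum1_card.
Qed.

(** Greedy choice: adjoin a largest remaining entry and take its value as the new threshold. For
    [k = 0] the threshold is the overall maximum, whence [0 < n]. *)
Lemma top_set (c : 'I_n -> R) k : (0 < n)%N -> (k <= n)%N ->
  exists S : {set 'I_n}, exists g : R, [/\ #|S| = k,
    forall i, i \in S -> g <= c i & forall i, i \notin S -> c i <= g].
Proof.
move=> n0; elim: k => [|k IH] kn.
  case: (arg_maxP c (P := xpredT) (i0 := Ordinal n0)) => // i _ hi.
  exists set0, (c i).
  by split=> [||j _]; [rewrite cards0 | move=> j; rewrite inE | exact: hi].
have [S [g [cS hin hout]]] := IH (ltnW kn).
have /set0Pn[i0 hi0] : ~: S != set0.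
  by rewrite -card_gt0 cardsCs setCK card_ord cS subn_gt0.
rewrite inE in hi0; case: (arg_maxP c (P := fun i => i \notin S) hi0) => i hi him.
exists (i |: S), (c i); split.
- by rewrite cardsU1 hi cS.
- move=> j /setU1P[-> //|/hin]; exact/le_trans/hout.
- by move=> j; rewrite !inE negb_or => /andP[_ hj]; apply: him.
Qed.

(** Abel summation by induction: lowering the multiplier of a nonnegative partial sum of [g] lowers
    the product. When [g] has total 0 the bound becomes 0, whatever the sign of [f]. *)
Lemma abel_sum_ge (f g : nat -> R) m :
  (forall i j, (i <= j < m)%N -> f j <= f i) ->
  (forall k, (k <= m)%N -> 0 <= \sum_(i < k) g i) ->
  f m.-1 * \sum_(i < m) g i <= \sum_(i < m) f i * g i.
Proof.
elim: m => [|m IH] fd g0; first by rewrite !big_ord0 mulr0.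
rewrite !big_ord_recr /= mulrDr lerD2r.
apply: le_trans (IH _ _) => [|i j /andP[ij jm]|k km]; last 2 first.
- by apply: fd; rewrite ij ltnW.
- by apply: g0; rewrite ltnW.
case: m {IH} fd g0 => [|m] fd g0; first by rewrite big_ord0 !mulr0.
by apply: ler_wpM2r; [apply: g0 | apply: fd; rewrite leqnSn ltnSn].
Qed.

End TopSums.

(** * Sums of eigenvalues *)

Section SubsetSums.
Variables (R : realType) (n k : nat).

Definition subset_sums : {mpoly R[n]} :=
  \prod_(S : {set 'I_n} | #|S| == k) \sum_(i in S) 'X_i.

Lemma meval_subset_sums (v : 'I_n -> R) :
  subset_sums.@[v] = \prod_(S : {set 'I_n} | #|S| == k) \sum_(i in S) v i.
Proof.
rewrite /subset_sums rmorph_prod; apply: eq_bigr => S _.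
by rewrite raddf_sum /=; apply: eq_bigr => i _; rewrite mevalXU.
Qed.

(** A permutation of the variables permutes the subsets of size [k]. *)
Lemma subset_sums_sym : subset_sums \is symmetric.
Proof.
apply/issymP => s; rewrite /subset_sums rmorph_prod /=.
have injs : injective (fun S : {set 'I_n} => s @: S).
  by apply: imset_inj; apply: perm_inj.
rewrite [RHS](reindex_inj injs) /=; apply: eq_big => S.
  by rewrite card_imset //; apply: perm_inj.
move=> _; rewrite raddf_sum big_imset /=; last by move=> i j _ _; apply: perm_inj.
by apply: eq_bigr => i _; rewrite /msym mmapX mmap1U.
Qed.

Lemma subset_sums_homog : exists N, subset_sums \is N.-homog.
Proof.
exists (\sum_(S : {set 'I_n} | #|S| == k) 1)%N; rewrite /subset_sums.
elim: (index_enum _) => [|S s IH]; first by rewrite !big_nil dhomog1.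
rewrite !big_cons; case: ifP => // _; apply: dhomogM IH.
by apply: rpred_sum => i _; rewrite dhomogX /= mdeg1.
Qed.

End SubsetSums.

Section Coordinates.
Variables (R : realType) (V : vectType R).
Implicit Types x y : V.

Lemma vcoordD x y i : vcoord (x + y) i = vcoord x i + vcoord y i.
Proof. by rewrite /vcoord linearD. Qed.

Lemma vcoordZ (a : R) x i : vcoord (a *: x) i = a * vcoord x i.
Proof. by rewrite /vcoord linearZ. Qed.

Lemma vcoordN x i : vcoord (- x) i = - vcoord x i.
Proof. by rewrite /vcoord linearN. Qed.

Lemma vcoord_surj (v : 'I_(\dim {:V}) -> R) : exists x, vcoord x =1 v.
Proof.
exists (\sum_i v i *: (vbasis {:V})`_i) => i.
by rewrite /vcoord coord_sum_free // (basis_free (vbasisP _)).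
Qed.

Lemma veval_homogZ k (Q : vpoly V) (a : R) x : Q \is k.-homog ->
  veval Q (a *: x) = a ^+ k * veval Q x.
Proof.
move=> hQ; rewrite /veval /meval -mmap_homogZ //.
by apply: eq_mmap => // i; rewrite vcoordZ.
Qed.

End Coordinates.

Lemma sumr_card (A : pzRingType) (I : finType) (S : {set I}) (c : A) :
  \sum_(i in S) c = #|S|%:R * c.
Proof. by rewrite sumr_const mulr_natl. Qed.

(** * Eigenvalues under shifts, scaling, negation and addition *)

Section Spectrum.
Variables (R : realType) (V : vectType R) (n : nat) (H : hyperbolic_system V n).
Local Notation p := (hs_poly H).
Local Notation e := (hs_dir H).
Local Notation lam x i := (lambda H x 0 i).
Implicit Types x y : V.

(** The factorization fixes the multiset of eigenvalues, and a multiset has only one decreasing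
    arrangement. *)
Lemma lambda_unique x (f : 'I_n -> R) :
  (forall i j : 'I_n, (i <= j)%N -> f j <= f i) ->
  (forall t, veval p (t *: e - x) = veval p e * \prod_i (t - f i)) ->
  forall i, lam x i = f i.
Proof.
move=> fd /perm_lambda hf i.
have tr : transitive (fun a b : R => b <= a).
  by move=> a b c ba ac; apply: le_trans ac ba.
have anti : antisymmetric (fun a b : R => b <= a).
  by move=> a b; rewrite andbC; apply: le_anti.
have srt (g : 'I_n -> R) : (forall i j : 'I_n, (i <= j)%N -> g j <= g i) ->
    sorted (fun a b : R => b <= a) [seq g i | i <- enum 'I_n].
  move=> gd; rewrite sorted_map.
  apply: (@sub_sorted _ (relpre val leq)) => [j k|]; first exact: gd.
  by rewrite -sorted_map val_enum_ord iota_sorted.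
have := sorted_eq tr anti (srt _ (lambda_decr H x)) (srt _ fd) hf.
by move=> /eq_in_map; apply; rewrite mem_enum.
Qed.

Lemma lambda_shift x (a : R) i : lam (x + a *: e) i = lam x i + a.
Proof.
apply: (lambda_unique (f := fun i => lam x i + a)) => [j k jk|t].
  by rewrite lerD2r lambda_decr.
have -> : t *: e - (x + a *: e) = (t - a) *: e - x.
  by rewrite scalerBl opprD [- x - _]addrC addrA.
rewrite veval_lambda; congr (_ * _); apply: eq_bigr => j _; ring.
Qed.

Lemma lambda_scale x (a : R) i : 0 <= a -> lam (a *: x) i = a * lam x i.
Proof.
move=> a0; apply: (lambda_unique (f := fun i => a * lam x i)) => [j k jk|t].
  by rewrite ler_wpM2l // lambda_decr.
(* The general argument divides by [a]; for [a = 0] the polynomial is [p(e) * t^n]. *)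
have [->|an0] := eqVneq a 0.
  rewrite scale0r subr0 (veval_homogZ _ _ (hs_homog H)) mulrC; congr (_ * _).
  rewrite (eq_bigr (fun=> t)) => [|j _]; last by rewrite mul0r subr0.
  by rewrite prodr_const card_ord.
have -> : t *: e - a *: x = a *: ((t / a) *: e - x).
  by rewrite scalerBr scalerA mulrC divfK.
rewrite (veval_homogZ _ _ (hs_homog H)) veval_lambda mulrCA; congr (_ * _).
rewrite -[in a ^+ n](card_ord n) -prodr_const -big_split /=.
by apply: eq_bigr => j _; rewrite mulrBr mulrCA mulfV // mulr1.
Qed.

Lemma lambda_opp x i : lam (- x) i = - lam x (rev_ord i).
Proof.
apply: (lambda_unique (f := fun i => - lam x (rev_ord i))) => [j k jk|t].
  by rewrite lerN2 lambda_decr //= leq_sub2l.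
have -> : t *: e - - x = (-1) *: ((- t) *: e - x).
  by rewrite scalerBr scalerA mulN1r !opprK scaleN1r opprK.
rewrite (veval_homogZ _ _ (hs_homog H)) veval_lambda mulrCA; congr (_ * _).
rewrite -[in (-1) ^+ n](card_ord n) -prodr_const -big_split /=.
rewrite (reindex_inj rev_ord_inj) /=; apply: eq_bigr => j _; ring.
Qed.

(** Let [Q] be the form whose value is the product of all [k]-subset sums of eigenvalues. The
    hypotheses put [x - a e] and [y - b e] in its open cone, so by [garding] it cannot vanish at
    [x + y - (a + b) e + t e] with [t > 0]; too small a sum over [S] would produce such a zero. *)
Lemma subset_sums_superadditive k (a b : R) x y (S : {set 'I_n}) :
  (0 < k)%N ->
  (forall T : {set 'I_n}, #|T| = k -> k%:R * a < \sum_(i in T) lam x i) ->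
  (forall T : {set 'I_n}, #|T| = k -> k%:R * b < \sum_(i in T) lam y i) ->
  #|S| = k -> k%:R * (a + b) <= \sum_(i in S) lam (x + y) i.
Proof.
move=> k0 ha hb cS; have [N hN] := subset_sums_homog R n k.
have [Q hQ evQ] := symmetric_lambda H (subset_sums_sym R n k) hN.
have kn0 : k%:R != 0 :> R by rewrite pnatr_eq0 -lt0n.
have evQe x' (t : R) : Q.@[fun i => vcoord x' i + t * vcoord e i] =
    \prod_(T : {set 'I_n} | #|T| == k) (k%:R * t + \sum_(i in T) lam x' i).
  rewrite (meval_eq _ (v2 := vcoord (x' + t *: e))) => [|i]; last first.
    by rewrite vcoordD vcoordZ.
  rewrite -/(veval Q (x' + t *: e)) evQ meval_subset_sums.
  apply: eq_bigr => T /eqP cT; under eq_bigr do rewrite lambda_shift.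
  by rewrite big_split /= sumr_card cT addrC.
(* Along direction [e], [Q] splits into factors [k * t + c] with [c] real. The splitting is proved
   as an identity of real polynomials and then evaluated at complex [t]. *)
have hypQ : nonreal_hyperbolic Q (vcoord e).
  move=> v t ht; have [z hz] := vcoord_surj v.
  pose q := mmap (@polyC R) (fun i => (v i)%:P + vcoord e i *: 'X) Q.
  have qE : q = \prod_(T : {set 'I_n} | #|T| == k)
      (k%:R *: 'X + (\sum_(i in T) lam z i)%:P).
    apply: horner_inj => s; rewrite horner_prod.
    under eq_bigr do rewrite hornerD hornerZ hornerX hornerC.
    rewrite -evQe -/(horner_eval s _) /q rmorph_mmap.
    apply: eq_mmap => [c|i] /=; rewrite /horner_eval ?hornerC //.
    by rewrite hornerD hornerC hornerZ hornerX hz mulrC.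
  have -> : mmap (real_complex R) (fun i => (v i)%:C + t * (vcoord e i)%:C) Q =
      (map_poly (real_complex R) q).[t].
    rewrite -/(horner_eval t _) /q !rmorph_mmap.
    apply: eq_mmap => [c|i] /=.
      by rewrite map_polyC /= /horner_eval hornerC.
    rewrite rmorphD /= map_polyZ map_polyX map_polyC /horner_eval.
    by rewrite hornerD hornerC hornerZ hornerX mulrC.
  rewrite qE rmorph_prod horner_prod; apply/prodf_neq0 => T _.
  rewrite rmorphD /= map_polyZ map_polyX map_polyC hornerD hornerZ hornerX hornerC.
  apply: contra ht => /eqP; case: (t) => c c' /= [_].
  by rewrite mul0r !addr0 => /eqP; rewrite mulf_eq0 (negPf kn0).
have cone x' a' :
    (forall T : {set 'I_n}, #|T| = k -> k%:R * a' < \sum_(i in T) lam x' i) ->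
    ray_cone Q (vcoord e) (vcoord (x' - a' *: e)).
  move=> ha' t t0; rewrite evQe; apply/prodf_neq0 => T /eqP cT.
  rewrite gt_eqF // -scaleNr; under eq_bigr do rewrite lambda_shift.
  rewrite big_split /= sumr_card cT mulrN.
  by rewrite ltr_wpDl ?mulr_ge0 // subr_gt0 ha'.
rewrite leNgt; apply/negP => hlt.
(* The value of the parameter at which the factor indexed by [S] vanishes. *)
pose t := a + b - k%:R^-1 * \sum_(i in S) lam (x + y) i.
have t0 : 0 < t by rewrite /t subr_gt0 ltr_pdivrMl ?ltr0n.
have := garding hQ hypQ (cone _ _ ha) (cone _ _ hb) t0.
pose z := x - a *: e + (y - b *: e).
rewrite (meval_eq _ (v2 := fun i => vcoord z i + t * vcoord e i)); last first.
  by move=> i; rewrite [in RHS]vcoordD.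
rewrite evQe => /prodf_neq0 /(_ S); rewrite cS eqxx => /(_ isT) /eqP; apply.
have -> : z = x + y + (- (a + b)) *: e.
  by rewrite /z scaleNr scalerDl opprD addrACA.
under eq_bigr do rewrite lambda_shift.
rewrite big_split /= sumr_card cS /t; field.
by [].
Qed.

End Spectrum.

(** * Subadditivity of top eigenvalue sums, the trace and the semi-inner product *)

Section Majorization.
Variables (R : realType) (V : vectType R) (n : nat) (H : hyperbolic_system V n).
Local Notation p := (hs_poly H).
Local Notation e := (hs_dir H).
Local Notation lam x i := (lambda H x 0 i).
Local Notation tr := (hyp_trace H).
Implicit Types x y z : V.

Definition lambda_top k x : R := \sum_(i < n | (i < k)%N) lam x i.

Lemma top_sum_lambda k x : (k <= n)%N -> top_sum (lambda H x) k = lambda_top k x.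
Proof.
move=> kn; rewrite /top_sum /decr_rearr lambda_seq /decr_sort sorted_sort.
- rewrite big_mkord (big_ord_widen n (fun i => (decr_sort _)`_i)) //.
  by apply: eq_bigr => i _; rewrite mxE.
- by move=> a b c ba ac; apply: le_trans ac ba.
- by apply: sort_sorted => a b; apply: le_total.
Qed.

Lemma majorized_lambda x y :
  (forall k, (k <= n)%N -> lambda_top k x <= lambda_top k y) -> tr x = tr y ->
  majorized (lambda H x) (lambda H y).
Proof.
move=> hk htr; split=> [k /andP[_ kn]|]; first by rewrite !top_sum_lambda // hk.
have topn z : lambda_top n z = tr z by apply: eq_bigl => i; rewrite ltn_ord.
by rewrite !top_sum_lambda // !topn.
Qed.

(** Up to sign, the right side is a sum of [#|T|] eigenvalues of [x], over the reversed indices. *)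
Lemma sum_lambda_opp_ge x (T : {set 'I_n}) :
  - lambda_top #|T| x <= \sum_(i in T) lam (- x) i.
Proof.
under eq_bigr do rewrite lambda_opp.
rewrite sumrN lerN2 -(card_imset T (@rev_ord_inj n)).
rewrite -(big_imset (h := @rev_ord n) (fun i => lam x i)) /=; last first.
  by move=> i j _ _; apply: rev_ord_inj.
exact: (subset_sum_le_top _ (lambda_decr H x)).
Qed.

(** Superadditivity is applied to [- x] and [- y], whose smallest [k]-subset sums are the negated
    top sums of [x] and [y]. *)
Lemma top_subadditive k x y : (k <= n)%N ->
  lambda_top k (x + y) <= lambda_top k x + lambda_top k y.
Proof.
case: k => [|k] kn; first by rewrite /lambda_top !big_pred0 // addr0.
rewrite leNgt; apply/negP => hlt.
(* [subset_sums_superadditive] needs strict bounds, so each one is loosened by [d]. A quarter of the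
   supposed excess is small enough: the two losses together stay below it. *)
pose d := (lambda_top k.+1 (x + y) - lambda_top k.+1 x - lambda_top k.+1 y) / 4.
have d0 : 0 < d by rewrite /d; lra.
have kn0 : k.+1%:R != 0 :> R by rewrite pnatr_eq0.
(* The last indices, over which the eigenvalues of [- (x + y)] sum to minus the top sum of
   [x + y]. *)
pose S := (@rev_ord n) @: [set i : 'I_n | (i < k.+1)%N].
have cS : #|S| = k.+1 by rewrite card_imset ?card_ord_lt //; apply: rev_ord_inj.
have low z (T : {set 'I_n}) : #|T| = k.+1 ->
    k.+1%:R * (k.+1%:R^-1 * (- lambda_top k.+1 z - d)) < \sum_(i in T) lam (- z) i.
  move=> cT; rewrite mulVKf //; apply: lt_le_trans (sum_lambda_opp_ge z T).
  by rewrite cT gtrDl oppr_lt0.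
have := subset_sums_superadditive (ltn0Sn k) (low x) (low y) cS.
rewrite -mulrDr mulVKf // -[- x - y]opprD big_imset /=; last first.
  by move=> i j _ _; apply: rev_ord_inj.
under eq_bigr do rewrite lambda_opp rev_ordK.
rewrite sumrN; have -> :
    \sum_(i in [set i : 'I_n | (i < k.+1)%N]) lam (x + y) i = lambda_top k.+1 (x + y).
  by apply: eq_bigl => i; rewrite inE.
by rewrite /d; lra.
Qed.

Lemma top_scale k x (a : R) : 0 <= a -> lambda_top k (a *: x) = a * lambda_top k x.
Proof.
by move=> a0; rewrite /lambda_top mulr_sumr; apply: eq_bigr => i _; rewrite lambda_scale.
Qed.

Lemma top_shift k x (a : R) : (k <= n)%N ->
  lambda_top k (x + a *: e) = lambda_top k x + k%:R * a.
Proof.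
move=> kn; rewrite /lambda_top; under eq_bigr do rewrite lambda_shift.
by rewrite big_split /= sumr_ord_lt_const.
Qed.

Lemma top_sum_le k (I : Type) (s : seq I) (F : I -> V) : (k <= n)%N ->
  lambda_top k (\sum_(i <- s) F i) <= \sum_(i <- s) lambda_top k (F i).
Proof.
move=> kn; elim: s => [|i s IH].
  by rewrite !big_nil -(scale0r e) top_scale // mul0r.
by rewrite !big_cons (le_trans (top_subadditive _ _ kn)) // lerD2l.
Qed.

(** The trace is the first elementary symmetric function of the eigenvalues, hence a form of degree
    1 in [x]. *)
Lemma hyp_trace_linear (a : R) x y : tr (a *: x + y) = a * tr x + tr y.
Proof.
have [Q hQ evQ] := symmetric_lambda H (mesym_sym n R 1) (dhomog_mesym n R 1).
have trQ z : tr z = veval Q z.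
  rewrite evQ mesym1E raddf_sum /=.
  by apply: eq_bigr => i _; rewrite mevalXU.
rewrite !trQ; apply: linear_form => // i.
by rewrite vcoordD vcoordZ.
Qed.

Lemma hyp_traceN x : tr (- x) = - tr x.
Proof.
have := hyp_trace_linear (-1) x 0; rewrite scaleN1r addr0 mulN1r => ->.
have := hyp_trace_linear 1 0 0; rewrite scale1r addr0 mul1r => h.
lra.
Qed.

(** The sum of squares is a symmetric form of degree 2. Bilinearity of the semi-inner product rests
    on this. *)
Lemma square_norm_poly : exists2 Q : vpoly V, Q \is 2.-homog &
  forall x, veval Q x = \sum_i lam x i ^+ 2.
Proof.
pose g : {mpoly R[n]} := \sum_i 'X_i ^+ 2.
have gsym : g \is symmetric.
  apply/issymP => s; rewrite /g raddf_sum [RHS](reindex_inj (@perm_inj _ s)) /=.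
  by apply: eq_bigr => i _; rewrite rmorphXn /= /msym mmapX mmap1U.
have ghom : g \is 2.-homog.
  apply: rpred_sum => i _; rewrite -[2%N]mul1n; apply: dhomogMn.
  by rewrite dhomogX /= mdeg1.
have [Q hQ evQ] := symmetric_lambda H gsym ghom; exists Q => // x.
rewrite evQ raddf_sum /=; apply: eq_bigr => i _.
by rewrite rmorphXn /= mevalXU.
Qed.

Lemma semi_innerE x y : semi_inner H x y =
  4^-1 * (\sum_i lam (x + y) i ^+ 2 - \sum_i lam (x - y) i ^+ 2).
Proof.
have en z : eucl_norm (lambda H z) ^+ 2 = \sum_i lam z i ^+ 2.
  by rewrite sqr_sqrtr // sumr_ge0 // => i _; apply: sqr_ge0.
by rewrite /semi_inner !en.
Qed.

Lemma semi_inner_linearr x (a : R) y z :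
  semi_inner H x (a *: y + z) = a * semi_inner H x y + semi_inner H x z.
Proof.
have [Q hQ evQ] := square_norm_poly; rewrite !semi_innerE -!evQ /veval.
have hB w : Q.@[vcoord (x + w)] - Q.@[vcoord (x - w)] =
    Q.@[fun i => vcoord x i + vcoord w i] - Q.@[fun i => vcoord x i - vcoord w i].
  by congr (_ - _); apply: meval_eq => i; rewrite vcoordD ?vcoordN.
rewrite !hB mulrCA -mulrDr; congr (_ * _).
rewrite -(quadratic_form_polar a (vcoord x) (vcoord y) (vcoord z) hQ).
by congr (_ - _); apply: meval_eq => i; rewrite vcoordD vcoordZ.
Qed.

Lemma semi_innerC x y : semi_inner H x y = semi_inner H y x.
Proof.
rewrite !semi_innerE [x + y]addrC; congr (_ * (_ - _)).
rewrite -opprB (reindex_inj rev_ord_inj) /=; apply: eq_bigr => i _.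
by rewrite lambda_opp rev_ordK sqrrN.
Qed.

Lemma semi_inner_suml x (I : Type) (s : seq I) (P : pred I) (F : I -> V) :
  semi_inner H (\sum_(i <- s | P i) F i) x = \sum_(i <- s | P i) semi_inner H (F i) x.
Proof.
have in0 : semi_inner H x 0 = 0.
  by have := semi_inner_linearr x 1 0 0; rewrite scale1r addr0 mul1r; lra.
elim/big_rec2: _ => [|i a y _ IH]; first by rewrite semi_innerC.
rewrite (semi_innerC _ x) -[F i]scale1r semi_inner_linearr mul1r scale1r.
by rewrite (semi_innerC x (F i)) (semi_innerC x y) IH.
Qed.

(** Adding or subtracting [e] shifts each eigenvalue by 1, and [((l + 1)^2 - (l - 1)^2) / 4 = l]. *)
Lemma semi_inner_dir x : semi_inner H x e = tr x.
Proof.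
rewrite semi_innerE -sumrB mulr_sumr; apply: eq_bigr => i _.
have -> : lam (x + e) i = lam x i + 1 by rewrite -lambda_shift scale1r.
have -> : lam (x - e) i = lam x i + -1 by rewrite -lambda_shift scaleN1r.
by field.
Qed.

Lemma top_lambda_nat k x : (k <= n)%N ->
  \sum_(i < k) (fun j => (decr_sort (zeros_mult (charpoly p e x)))`_j) i = lambda_top k x.
Proof.
move=> kn; rewrite (big_ord_widen n (fun i => (decr_sort _)`_i)) //.
by apply: eq_bigr => i _; rewrite mxE.
Qed.

(* Since lambda (x + y) is majorized by lambda x + lambda y, its norm is at
   most that of lambda x + lambda y; polarize. *)
Lemma semi_inner_le_lambda x y : semi_inner H x y <= \sum_i lam x i * lam y i.
Proof.
have [Q hQ evQ] := square_norm_poly.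
have polar : \sum_i lam (x + y) i ^+ 2 =
    \sum_i lam x i ^+ 2 + \sum_i lam y i ^+ 2 + 2 * semi_inner H x y.
  rewrite semi_innerE -!evQ /veval.
  have -> : Q.@[vcoord (x + y)] = Q.@[fun i => vcoord x i + vcoord y i].
    by apply: meval_eq => i; rewrite vcoordD.
  have -> : Q.@[vcoord (x - y)] = Q.@[fun i => vcoord x i - vcoord y i].
    by apply: meval_eq => i; rewrite vcoordD vcoordN.
  by rewrite {1}quadratic_formD //; field.
pose L z j := (decr_sort (zeros_mult (charpoly p e z)))`_j.
have LE z (i : 'I_n) : L z i = lam z i by rewrite mxE.
pose g j := L x j + L y j - L (x + y) j.
have gsum k : (k <= n)%N ->
    \sum_(i < k) g i = lambda_top k x + lambda_top k y - lambda_top k (x + y).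
  by move=> kn; rewrite /g sumrB big_split /= !top_lambda_nat.
have topn z : lambda_top n z = tr z by apply: eq_bigl => i; rewrite ltn_ord.
(* The partial sums of [g] are nonnegative by subadditivity and its total is 0 by additivity of the
   trace, so Abel summation applies. *)
have : 0 <= \sum_(i < n) L (x + y) i * g i.
  have := @abel_sum_ge _ (L (x + y)) g n.
  rewrite gsum // !topn -[x]scale1r hyp_trace_linear scale1r mul1r subrr mulr0.
  apply=> [i j /andP[ij jn]|k kn].
    by have := lambda_decr H (x + y) (i := Ordinal (leq_ltn_trans ij jn))
         (j := Ordinal jn) ij; rewrite -!LE.
  by rewrite gsum // subr_ge0 top_subadditive.
have -> : \sum_(i < n) L (x + y) i * g i =
    \sum_i lam (x + y) i * (lam x i + lam y i) - \sum_i lam (x + y) i ^+ 2.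
  rewrite -sumrB; apply: eq_bigr => i _; rewrite /g !LE; ring.
(* Expanding this square takes the place of the Cauchy-Schwarz inequality in comparing the two
   norms. *)
have sq : 0 <= \sum_i (lam x i + lam y i - lam (x + y) i) ^+ 2.
  by apply: sumr_ge0 => i _; apply: sqr_ge0.
have sqE : \sum_i (lam x i + lam y i - lam (x + y) i) ^+ 2 =
    \sum_i lam x i ^+ 2 + \sum_i lam y i ^+ 2 + 2 * \sum_i lam x i * lam y i
    - 2 * \sum_i lam (x + y) i * (lam x i + lam y i) + \sum_i lam (x + y) i ^+ 2.
  rewrite !mulr_sumr -sumrN -!big_split /=; apply: eq_bigr => i _; ring.
lra.
Qed.

End Majorization.

(** * Doubly stochastic matrices *)

Section DoublyStochastic.
Variables (R : realType) (V : vectType R) (n : nat) (H : hyperbolic_system V n).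
Local Notation e := (hs_dir H).
Local Notation lam x i := (lambda H x 0 i).
Local Notation tr := (hyp_trace H).
Local Notation top := (lambda_top H).
Implicit Types x y z : V.

(** The largest eigenvalue of [- x] is minus the smallest one of [x]. In this form, cone membership
    is controlled by bounds on [top 1]. *)
Lemma hyp_coneP x : (0 < n)%N -> hyp_cone H x <-> top 1 (- x) <= 0.
Proof.
move=> n0.
have -> : top 1 (- x) = - lam x (rev_ord (Ordinal n0)).
  rewrite /lambda_top (bigD1 (Ordinal n0)) //= big1 => [|i /andP[]]; last first.
    by rewrite ltnS leqn0 -val_eqE /= => /eqP ->.
  by rewrite addr0 lambda_opp.
rewrite oppr_le0; split=> [|h i]; first by apply.
by apply: le_trans h _; apply: lambda_decr; rewrite /= subn1 -ltnS prednK.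
Qed.

Lemma hyp_cone_sum (I : finType) (P : pred I) (F : I -> V) : (0 < n)%N ->
  (forall i, hyp_cone H (F i)) -> hyp_cone H (\sum_(i | P i) F i).
Proof.
move=> n0 hF; apply/(hyp_coneP _ n0); rewrite -sumrN big_mkcond.
apply: le_trans (top_sum_le _ _ _ n0) _; apply: sumr_le0 => i _.
case: (P i); first exact/hyp_coneP.
by rewrite -(scale0r e) top_scale // mul0r.
Qed.

Lemma hyp_trace_sum (I : finType) (P : pred I) (F : I -> V) :
  tr (\sum_(i | P i) F i) = \sum_(i | P i) tr (F i).
Proof.
have tr0 : tr 0 = 0 by have := hyp_traceN H 0; rewrite oppr0; lra.
elim/big_rec2: _ => [|i a y _ <-] //.
by rewrite -[F i]scale1r hyp_trace_linear mul1r scale1r.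
Qed.

Lemma hyp_traceZ (a : R) x : tr (a *: x) = a * tr x.
Proof.
have tr0 : tr 0 = 0 by have := hyp_traceN H 0; rewrite oppr0; lra.
by rewrite -[a *: x]addr0 hyp_trace_linear tr0 addr0.
Qed.

(** For [a >= 0], a partial sum of nonnegative eigenvalues is at most the trace; for [a < 0], every
    eigenvalue of [a *: x] is nonpositive. *)
Lemma top_scale_cone k (a : R) x : hyp_cone H x -> tr x = 1 ->
  top k (a *: x) <= Num.max a 0.
Proof.
move=> hx trx; have [a0|a0] := leP 0 a.
  rewrite top_scale // -[leRHS]mulr1 -trx ler_wpM2l //.
  rewrite /lambda_top big_mkcond; apply: ler_sum => i _.
  by case: ifP => // _; apply: hx.
rewrite -[a]opprK scaleNr -scalerN top_scale ?oppr_ge0 ?(ltW a0) //.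
rewrite mulr_ge0_le0 ?oppr_ge0 ?(ltW a0) //.
by apply: sumr_le0 => i _; rewrite lambda_opp oppr_le0; apply: hx.
Qed.

(** In degree 0 the empty sum would equal the nonzero vector [e]. *)
Lemma degree_gt0 (A : n.-tuple V) : e_doubly_stochastic H A -> (0 < n)%N.
Proof.
move: A; have := hs_dir_neq0 H; case: (n) (H) => // G e0 A' [_ _].
by rewrite big_ord0 => h; rewrite -h eqxx in e0.
Qed.

Section Odot.
Variables A B : n.-tuple V.
Hypotheses (hA : e_doubly_stochastic H A) (hB : e_doubly_stochastic H B).
Local Notation a := (tnth A).
Local Notation b := (tnth B).

Let n_gt0 : (0 < n)%N := degree_gt0 hA.

Lemma odot_linear : linear (odot H A B).
Proof.
move=> c x y; rewrite /odot scaler_sumr -big_split /=.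
by apply: eq_bigr => i _; rewrite semi_inner_linearr scalerDl scalerA.
Qed.

(** Since each [a i] has trace 1, the trace is the sum of the [<b_i, x>], which is [<e, x>]. *)
Lemma odot_trace x : tr (odot H A B x) = tr x.
Proof.
have [_ trA _] := hA; have [_ _ sumB] := hB.
rewrite hyp_trace_sum -semi_inner_dir semi_innerC -sumB semi_inner_suml.
by apply: eq_bigr => i _; rewrite hyp_traceZ trA mulr1.
Qed.

Lemma semi_inner_subset_le (S : {set 'I_n}) x :
  \sum_(i in S) semi_inner H (b i) x <= top #|S| x.
Proof.
have [coneB trB sumB] := hB.
rewrite -semi_inner_suml; apply: le_trans (semi_inner_le_lambda _ _ _) _.
apply: weighted_sum_le_top => [i j|i||].
- exact: lambda_decr.
- rewrite hyp_cone_sum //=.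
  (* The upper bound 1: the sum of [b] over the complement of [S] is [e] minus the sum over [S], and
     it lies in the cone. *)
  have := @hyp_cone_sum _ [pred i | i \notin S] b n_gt0 coneB (rev_ord i).
  have -> : \sum_(j | j \notin S) b j = - (\sum_(j in S) b j) + 1 *: e.
    by rewrite -sumB scale1r (bigID (mem S) xpredT) /= addKr.
  by rewrite lambda_shift lambda_opp rev_ordK addrC subr_ge0.
- by rewrite -[X in (_ <= X)%N]card_ord max_card.
- rewrite -[LHS]/(tr _) hyp_trace_sum (eq_bigr (fun=> 1)) => [|i _]; last exact: trB.
  by rewrite sumr_card mulr1.
Qed.

(* With c_i = <b_i, x> and g the k-th largest c_i, the sum of the k largest
   eigenvalues of (c_i - g) a_i is at most the positive part of c_i - g. *)
Lemma odot_top k x : (k <= n)%N -> top k (odot H A B x) <= top k x.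
Proof.
move=> kn; have [coneA trA sumA] := hA.
pose c i := semi_inner H (b i) x.
have [S [g [cS hin hout]]] := top_set c n_gt0 kn.
have -> : odot H A B x = \sum_i (c i - g) *: a i + g *: e.
  rewrite -sumA scaler_sumr -big_split /=.
  by apply: eq_bigr => i _; rewrite -scalerDl subrK.
rewrite top_shift //.
apply: le_trans (_ : \sum_i Num.max (c i - g) 0 + k%:R * g <= _).
  rewrite lerD2r; apply: le_trans (top_sum_le _ _ _ kn) _.
  by apply: ler_sum => i _; apply: top_scale_cone.
have -> : \sum_i Num.max (c i - g) 0 = \sum_(i in S) (c i - g).
  rewrite [RHS]big_mkcond; apply: eq_bigr => i _; case: ifP => iS.
    by rewrite max_l // subr_ge0 hin.
  by rewrite max_r // subr_le0 hout // iS.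
by rewrite sumrB sumr_card cS subrK -[in leRHS]cS semi_inner_subset_le.
Qed.

End Odot.
End DoublyStochastic.

Theorem theorem5p6 (R : realType) (V : vectType R) (n : nat)
    (H : hyperbolic_system V n) (A B : n.-tuple V)
    (hA : e_doubly_stochastic H A) (hB : e_doubly_stochastic H B) :
  lambda_doubly_stochastic H (odot H A B)
  /\ (hyp_complete H -> operator_doubly_stochastic H (odot H A B)).
Proof.
split.
  split; first exact: odot_linear.
  move=> x; apply: majorized_lambda (odot_trace hA hB x) => k.
  exact: odot_top.
have n0 := degree_gt0 hA; move=> _; split; first exact: odot_linear.
(* Cone preservation is the case [k = 1] of [odot_top], applied to [- x]. *)
- move=> x /(hyp_coneP H x n0) hx; apply/(hyp_coneP H _ n0); apply: le_trans hx.
  have -> : - odot H A B x = odot H A B (- x).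
    have := odot_linear H A B (-1) x 0; rewrite scaleN1r scaleN1r addr0 => ->.
    have := odot_linear H A B 1 0 0; rewrite !scale1r !addr0 => h0.
    rewrite -[LHS]addr0; congr (_ + _).
    by apply: (addrI (odot H A B 0)); rewrite addr0 -h0.
  exact: odot_top.
(* At [e] each coefficient is [<b_i, e> = tr b_i = 1], which leaves the sum of the [a_i]. *)
- have [_ trB _] := hB; have [_ _ sumA] := hA.
  rewrite -[RHS]sumA; apply: eq_bigr => i _.
  by rewrite semi_inner_dir trB scale1r.
- exact: odot_trace.
Qed.
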